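(* Let $\mathcal{S}$ be a set of homogeneous multilinear polynomials with integer coefficients. For a homogeneous multilinear polynomial $P(X_1,\ldots,X_m)=\sum_{\sigma\in S_m}c_\sigma X_{\sigma(1)}\cdots X_{\sigma(m)}\in\mathbb{Z}\{X_1,\ldots,X_m\}$ and $1\le i<j\le m$ put $$\Theta_{i,j}(P)=\sum_{\{\sigma\in S_m\,:\,\sigma^{-1}(i)<\sigma^{-1}(j)\}}c_\sigma\in\mathbb{Z}.$$ Then there is a noncommutative ring $R$ for which every element of $\mathcal{S}$ is an identity if and only if there is some fixed prime $p$ such that whenever $P(X_1,\ldots,X_m)=\sum_{\sigma\in S_m}c_\sigma X_{\sigma(1)}\cdots X_{\sigma(m)}$ is an element of $\mathcal{S}$ the following hold: (1) $p\mid P(1,1,\ldots,1)$; (2) $p\mid\Theta_{i,j}(P)$ for all $1\le i<j\le m$. Moreover, if $p$ is such a prime, then every element of $\mathcal{S}$ is an identity for the noncommutative ring $\mathbb{F}_p\{U,V\}/(U^2,V^2,UV)$.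
   Context: All rings are associative with an identity element $1$. A noncommutative ring is a ring that is not commutative. $C\{X_1,\ldots,X_m\}$ denotes the free associative unital $C$-algebra on noncommuting variables. The number of variables $m$ may vary with the element of $\mathcal{S}$, and $\mathcal{S}$ may be infinite. A polynomial $P\in\mathbb{Z}\{X_1,\ldots,X_m\}$ is an identity for a ring $R$ if $P(r_1,\ldots,r_m)=0$ for all $r_1,\ldots,r_m\in R$. $(U^2,V^2,UV)$ denotes the two-sided ideal generated by these elements. *)

(* Defs.v *)
From HB Require Import structures.
From mathcomp Require Import all_boot perm all_algebra.
From mathcomp Require Import boolp.
From mathcomp Require Import monalg.

Set Implicit Arguments.
Unset Strict Implicit.
Unset Printing Implicit Defensive.

Import GRing.Theory.
Local Open Scope ring_scope.
Local Open Scope quotient_scope.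

(* The free associative unital C-algebra on noncommuting variables indexed
   by I, as the monoid algebra of the free monoid of words over I. *)
Notation "{ 'fralg' C [ I ] }" := {malg C[{fmonom I}]}
  (at level 0, C, I at level 2, format "{ 'fralg'  C [ I ] }") : type_scope.

Definition fvar (C : nzRingType) (I : choiceType) (i : I) : {fralg C[I]} :=
  << fmu i >>.

Section Evaluation.
Variables (R : nzRingType) (I : choiceType).

Definition fmeval (r : I -> R) (w : {fmonom I}) : R := \prod_(i <- w) r i.

Definition freval (r : I -> R) (P : {fralg int[I]}) : R :=
  mmap intr (fmeval r) P.

Definition is_identity (P : {fralg int[I]}) : Prop :=
  forall r : I -> R, freval r P = 0.
End Evaluation.
Arguments is_identity R {I} P.

Section Multilinear.
Variable m : nat.
Implicit Types (P : {fralg int['I_m]}) (s : 'S_m).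

Definition perm_word s : {fmonom 'I_m} := \big[mmul/mone]_(i < m) fmu (s i).

Definition multilinear P : Prop :=
  exists c : 'S_m -> int, P = \sum_s << c s *g perm_word s >>.

(* [P@_(perm_word s)] is c_s, the coefficient of X_{s(1)} ... X_{s(m)} in P. *)
Definition Theta (i j : 'I_m) P : int :=
  \sum_(s : 'S_m | (s^-1%g i < s^-1%g j)%N) P@_(perm_word s).
End Multilinear.

Section IdealQuotient.
Variables (R : pzRingType) (gens : seq R).

Definition is_ideal (J : R -> Prop) : Prop :=
  [/\ J 0, forall x y, J x -> J y -> J (x - y),
      forall a x, J x -> J (a * x) & forall a x, J x -> J (x * a)].

Definition ideal_gen : {pred R} := fun x =>
  `[< forall J : R -> Prop, is_ideal J -> (forall g, g \in gens -> J g) -> J x >].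

Lemma ideal_genP x :
  reflect (forall J : R -> Prop, is_ideal J -> (forall g, g \in gens -> J g) -> J x)
          (x \in ideal_gen).
Proof. exact: asboolP. Qed.

Lemma ideal_gen_zmod_closed : zmod_closed ideal_gen.
Proof.
split=> [|x y /ideal_genP Ix /ideal_genP Iy]; apply/ideal_genP => J idJ Jg.
  by case: idJ.
by have [_ JB _ _] := idJ; apply: JB; [apply: Ix | apply: Iy].
Qed.
HB.instance Definition _ := GRing.isZmodClosed.Build R ideal_gen
  ideal_gen_zmod_closed.

Lemma ideal_genMl a x : x \in ideal_gen -> a * x \in ideal_gen.
Proof.
move=> /ideal_genP Ix; apply/ideal_genP => J idJ Jg.
by have [_ _ JM _] := idJ; apply: JM; exact: Ix.
Qed.

Lemma ideal_genMr a x : x \in ideal_gen -> x * a \in ideal_gen.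
Proof.
move=> /ideal_genP Ix; apply/ideal_genP => J idJ Jg.
by have [_ _ _ JM] := idJ; apply: JM; exact: Ix.
Qed.

(* The ring structure that the library puts on [Quotient.quot] is limited to
   commutative rings, hence this alias to carry the noncommutative one. *)
Definition idealquot : Type := Quotient.quot ideal_gen.
HB.instance Definition _ := GRing.Zmodule.on idealquot.
HB.instance Definition _ : EqQuotient R (Quotient.equiv ideal_gen) idealquot :=
  EqQuotient.on idealquot.

Lemma idealquot_eq (x y : R) :
  (\pi_idealquot x == \pi_idealquot y) = (x - y \in ideal_gen).
Proof. by rewrite (Quotient.idealrBE ideal_gen). Qed.

Definition iq_one : idealquot := \pi_idealquot 1.
Definition iq_mul : idealquot -> idealquot -> idealquot :=
  lift_op2 idealquot *%R.

Lemma iq_mulE (x y : R) :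
  iq_mul (\pi_idealquot x) (\pi_idealquot y) = \pi_idealquot (x * y).
Proof.
rewrite /iq_mul -lock; apply/eqP; rewrite idealquot_eq.
set x' := repr _; set y' := repr _.
have -> : x' * y' - x * y = (x' - x) * y' + x * (y' - y).
  by rewrite mulrBl mulrBr addrA subrK.
by apply: rpredD; [apply: ideal_genMr | apply: ideal_genMl];
  rewrite -idealquot_eq reprK.
Qed.

Lemma iq_addE (x y : R) :
  \pi_idealquot x + \pi_idealquot y = \pi_idealquot (x + y).
Proof. exact/esym/(Quotient.pi_add ideal_gen). Qed.

Lemma iq_mulA : associative iq_mul.
Proof.
by move=> x y z; rewrite -[x]reprK -[y]reprK -[z]reprK !iq_mulE mulrA.
Qed.
Lemma iq_mul1 : left_id iq_one iq_mul.
Proof. by move=> x; rewrite -[x]reprK iq_mulE mul1r. Qed.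
Lemma iq_mulr1 : right_id iq_one iq_mul.
Proof. by move=> x; rewrite -[x]reprK iq_mulE mulr1. Qed.
Lemma iq_mulDl : left_distributive iq_mul +%R.
Proof.
move=> x y z; rewrite -[x]reprK -[y]reprK -[z]reprK.
by rewrite iq_addE !iq_mulE iq_addE mulrDl.
Qed.
Lemma iq_mulDr : right_distributive iq_mul +%R.
Proof.
move=> x y z; rewrite -[x]reprK -[y]reprK -[z]reprK.
by rewrite iq_addE !iq_mulE iq_addE mulrDr.
Qed.

HB.instance Definition _ := GRing.Zmodule_isPzRing.Build idealquot
  iq_mulA iq_mul1 iq_mulr1 iq_mulDl iq_mulDr.

Lemma iq_mulrE (x y : R) :
  \pi_idealquot x * \pi_idealquot y = \pi_idealquot (x * y).
Proof. exact: iq_mulE. Qed.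

Lemma iq0E : 0 = \pi_idealquot 0.
Proof. by apply: (addrI (\pi_idealquot 0)); rewrite iq_addE !addr0. Qed.

Lemma iq1E : 1 = \pi_idealquot 1.
Proof. by []. Qed.
End IdealQuotient.

Section UVRing.
Variable p : nat.

(* 'F_p is the field with p elements only for p prime. *)
Definition varU : {fralg 'F_p['I_2]} := fvar _ 0.
Definition varV : {fralg 'F_p['I_2]} := fvar _ 1.

Definition uvring : Type :=
  idealquot [:: varU ^+ 2; varV ^+ 2; varU * varV].
HB.instance Definition _ := GRing.PzRing.on uvring.

Lemma uvring_oner_neq0 : (1 : uvring) != 0.
Proof.
have cM (x y : {fralg 'F_p['I_2]}) : (x * y)@_mone = x@_mone * y@_mone.
  exact: rmorphM.
have c0 (i : 'I_2) : (fvar 'F_p i)@_mone = 0.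
  by rewrite mcoeffU fmP fmU fm1.
apply/negP; rewrite [1]iq1E [0]iq0E idealquot_eq subr0 => /ideal_genP I1.
suff /eqP : (1 : {fralg 'F_p['I_2]})@_mone = 0 by rewrite rmorph1 oner_eq0.
apply: (I1 (fun x => x@_mone = 0)) => [|g].
- split=> [|x y Jx Jy|a x Jx|a x Jx]; first exact: mcoeff0.
  + by rewrite mcoeffB Jx Jy subr0.
  + by rewrite cM Jx mulr0.
  + by rewrite cM Jx mul0r.
- by rewrite !inE => /or3P[] /eqP->; rewrite ?expr2 cM c0 mul0r.
Qed.
HB.instance Definition _ :=
  GRing.PzSemiRing_isNonZero.Build uvring uvring_oner_neq0.
End UVRing.

(* A noncommutative ring is nonzero, so nothing is lost in restricting to
   [nzRingType]. *)
Definition noncommutative (R : nzRingType) : Prop :=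
  ~ commutative (@GRing.mul R).

(* S is a set of polynomials in varying numbers of variables: [S m P] means
   that P, in the m variables indexed by 'I_m, belongs to S. *)
Definition admissible_prime (S : forall m, {fralg int['I_m]} -> Prop) (p : nat) :
    Prop :=
  prime p /\
  forall (m : nat) (P : {fralg int['I_m]}), S m P ->
    (p%:Z %| freval (fun _ => 1 : int) P)%Z /\
    (forall i j : 'I_m, (i < j)%N -> (p%:Z %| Theta i j P)%Z).

(* Main.v *)
(* Let R be noncommutative with z = xy - yx nonzero. An identity P gives
   P(1,...,1) z = 0; substituting x for X_i, y for X_j and 1 for the other
   variables then gives Theta_ij(P) z = 0. So all these integers lie in the
   annihilator of z, a proper ideal of Z, hence are multiples of one prime.
   Conversely, every element of F_p{U,V}/(U^2,V^2,UV) is an integer plus an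
   element of the augmentation ideal, whose cube is 0. Expanding a product of
   such elements to second order and summing over the permutations, the
   coefficients are P(1,...,1), the Theta_ij(P) and P(1,...,1) - Theta_ij(P),
   all multiples of p. *)
Require Import Defs.
From mathcomp Require Import all_boot perm all_algebra.
From mathcomp Require Import monalg.
From mathcomp Require Import boolp.

Set Implicit Arguments.
Unset Strict Implicit.
Unset Printing Implicit Defensive.

Import GRing.Theory.
Local Open Scope ring_scope.
Local Open Scope quotient_scope.

(** * Evaluation of multilinear polynomials *)

Lemma fmeval_perm_word (R : nzRingType) m (r : 'I_m -> R) (s : 'S_m) :
  fmeval r (perm_word s) = \prod_(i < m) r (s i).
Proof.
rewrite /perm_word (big_morph (fmeval r) (op1 := *%R) (id1 := 1)).
- by apply: eq_bigr => i _; rewrite /fmeval fmU big_seq1.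
- by move=> u v; rewrite /fmeval fmM big_cat.
- by rewrite /fmeval fm1 big_nil.
Qed.

Lemma perm_wordE m (s : 'S_m) :
  perm_word s = map s (index_enum 'I_m) :> seq 'I_m.
Proof.
rewrite /perm_word; elim: (index_enum _) => [|i e IHe] /=.
  by rewrite big_nil fm1.
by rewrite big_cons fmM fmU IHe.
Qed.

Lemma perm_word_inj m : injective (@perm_word m).
Proof.
move=> s t /(congr1 (@fmonom_val _)); rewrite !perm_wordE => /eq_in_map st.
by apply/permP => i; apply: st; rewrite mem_index_enum.
Qed.

(** Distinct permutations give distinct words, so the coefficients in any such expression of P are
    the ones that [Theta] reads off. *)
Lemma multilinearE m (P : {fralg int['I_m]}) : multilinear P ->
  P = \sum_(s : 'S_m) << P@_(perm_word s) *g perm_word s >>.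
Proof.
case=> c ->; apply: eq_bigr => s _; congr << _ *g _ >>.
rewrite raddf_sum (bigD1 s) //= mcoeffUU big1 ?addr0 // => t nts.
by rewrite mcoeffU (inj_eq (@perm_word_inj m)) (negPf nts).
Qed.

Lemma freval_multilinear (R : nzRingType) m (r : 'I_m -> R) P :
  multilinear P ->
  freval r P = \sum_(s : 'S_m) (\prod_(i < m) r (s i)) *~ P@_(perm_word s).
Proof.
move=> /multilinearE {1}->; rewrite /freval raddf_sum; apply: eq_bigr => s _.
by rewrite /= mmapU fmeval_perm_word mulrzl.
Qed.

Lemma freval1 (R : nzRingType) m (P : {fralg int['I_m]}) :
  multilinear P ->
  freval (fun=> 1 : R) P = (freval (fun=> 1 : int) P)%:~R.
Proof.
move=> mP; rewrite !freval_multilinear // raddf_sum; apply: eq_bigr => s _.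
by rewrite !big1 // intz.
Qed.

Lemma sum_coeff m (P : {fralg int['I_m]}) : multilinear P ->
  \sum_(s : 'S_m) P@_(perm_word s) = freval (fun=> 1 : int) P.
Proof.
move=> mP; rewrite freval_multilinear //; apply: eq_bigr => s _.
by rewrite big1 // intz.
Qed.

(** * From an identity to a prime, by way of a commutator *)

(** The factors need not commute, so [a < b] fixes their order. Induction removes the factor at
    [ord0], which is never the one at [b]. *)
Lemma prod_ord2 (R : nzRingType) m (F : 'I_m -> R) (a b : 'I_m) : (a < b)%N ->
  (forall k, k != a -> k != b -> F k = 1) -> \prod_k F k = F a * F b.
Proof.
elim: m F a b => [|m IHm] F a b; first by case: a.
rewrite big_ord_recl; case: (unliftP ord0 b) => [b'|] -> //.
case: (unliftP ord0 a) => [a'|] ->; rewrite ?lift0 ?ltnS => ab F1.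
  rewrite F1 ?neq_lift // mul1r (IHm (F \o lift ord0) _ _ ab) // => k na nb.
  by rewrite /= F1 ?(inj_eq lift_inj).
congr (_ * _); rewrite (big_only1 b') // => k nk _.
by rewrite F1 ?(inj_eq lift_inj) // eq_sym neq_lift.
Qed.

(** A permutation contributes xy or yx according to which of i and j comes first, so the
    substitution yields Theta xy + (P(1,...,1) - Theta) yx = 0, where P(1,...,1) yx = 0. *)
Lemma is_identity_Theta (R : nzRingType) m (P : {fralg int['I_m]})
    (i j : 'I_m) (x y : R) :
  multilinear P -> is_identity R P -> (i < j)%N ->
  (x * y - y * x) *~ Theta i j P = 0.
Proof.
move=> mP idP ltij; have nij : i != j by rewrite neq_ltn ltij.
have := idP (fun=> 1); rewrite (freval_multilinear _ mP).
have := idP (fun k => if k == i then x else if k == j then y else 1).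
rewrite (freval_multilinear _ mP) => E1 E2.
transitivity (\sum_(s : 'S_m) (x * y) *~ P@_(perm_word s)
   *+ ((s^-1)%g i < (s^-1)%g j)%N
  - \sum_(s : 'S_m) (y * x) *~ P@_(perm_word s)
   *+ ((s^-1)%g i < (s^-1)%g j)%N).
  rewrite -sumrB /Theta [in LHS]big_mkcond raddf_sum; apply: eq_bigr => s _.
  by case: ifP; rewrite /= ?mulr0z ?subr0 // mulrzBl.
have {}E2 : \sum_(s : 'S_m) (y * x) *~ P@_(perm_word s) = 0.
  rewrite -[RHS](mulr0 (y * x)) -[in RHS]E2 mulr_sumr; apply: eq_bigr => s _.
  by rewrite big1 // mulrzAr mulr1.
transitivity (\sum_(s : 'S_m) (\prod_k (if s k == i then x
    else if s k == j then y else 1)) *~ P@_(perm_word s)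
  - \sum_(s : 'S_m) (y * x) *~ P@_(perm_word s)); last by rewrite E1 E2 subr0.
(* After subtraction of yx, a permutation placing i before j leaves xy - yx, and any other leaves
   0. *)
rewrite -!sumrB; apply: eq_bigr => s _ /=.
have Fs k : (s k == i) = (k == (s^-1)%g i) by rewrite (canF_eq (permK s)).
have Fs' k : (s k == j) = (k == (s^-1)%g j) by rewrite (canF_eq (permK s)).
case: ltngtP => [lt|lt|/val_inj/perm_inj/eqP]; last by rewrite (negPf nij).
  rewrite mulr1n mulr1n (prod_ord2 lt) => [|k]; first last.
    by rewrite Fs Fs' => /negPf-> /negPf->.
  by rewrite !permKV !eqxx eq_sym (negPf nij).
rewrite subr0 (prod_ord2 lt) => [|k]; first last.
  by rewrite Fs Fs' => /negPf-> /negPf->.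
by rewrite !permKV !eqxx eq_sym (negPf nij) subrr.
Qed.

(* p is a prime factor of the generator of the annihilator of z, or 2 if that
   annihilator is 0. *)
Lemma prime_torsion (V : zmodType) (z : V) : z != 0 ->
  exists2 p, prime p & forall n : int, z *~ n = 0 -> (p%:Z %| n)%Z.
Proof.
move=> nz; pose T n := (0 < n)%N && (z *+ n == 0).
have TN (n : int) : z *~ n = 0 -> (0 < `|n|)%N -> T `|n|%N.
  rewrite /T => zn ->/=; case: (intP n) zn => [//|k|k] zn.
  - by rewrite absz_nat; apply/eqP.
  - by rewrite abszN absz_nat -oppr_eq0; move/eqP: zn; rewrite mulrNz.
have [exT|noT] := pselect (exists n, T n); last first.
  exists 2%N => // n zn; case: (posnP `|n|%N) => [/eqP|/(TN _ zn) Tn].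
    by rewrite absz_eq0 => /eqP->; rewrite dvdz0.
  by case: noT; exists `|n|%N.
case: (ex_minnP exT) => d /andP[d0 /eqP zd] dmin.
(* As z is nonzero, its least positive annihilator [d] is not 1 and so has a prime factor. *)
have d1 : (1 < d)%N.
  by case: d d0 zd {dmin} => [|[|d]] // _ /eqP; rewrite mulr1n (negPf nz).
exists (pdiv d); first exact: pdiv_prime.
move=> n zn; rewrite dvdzE /=; apply: (dvdn_trans (pdiv_dvd d)).
have zn' : z *+ `|n|%N = 0.
  case: (posnP `|n|%N) => [->|/(TN _ zn)/andP[_ /eqP]//]; exact: mulr0n.
(* The remainder of |n| modulo [d] also annihilates z; by minimality of [d] it is 0. *)
have zr : z *+ (`|n| %% d)%N = 0.
  move: zn'; rewrite {1}(divn_eq `|n| d) mulrnDr mulnC mulrnA zd.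
  by rewrite mul0rn add0r.
case: (posnP (`|n| %% d)%N) => [/eqP//|r0].
have /dmin : T (`|n| %% d)%N by rewrite /T r0 zr eqxx.
by rewrite leqNgt ltn_pmod.
Qed.

(** One nonzero commutator serves for all of [S], so the prime is the same for every polynomial and
    every m. *)
Lemma identity_admissible (S : forall m : nat, {fralg int['I_m]} -> Prop)
    (R : nzRingType) :
  (forall m (P : {fralg int['I_m]}), S m P -> multilinear P) ->
  noncommutative R ->
  (forall m (P : {fralg int['I_m]}), S m P -> is_identity R P) ->
  exists p, admissible_prime S p.
Proof.
move=> mS /existsNP[x /existsNP[y nxy]] idS.
have [|p p_prime pP] := @prime_torsion R (x * y - y * x).
  by rewrite subr_eq0; apply/eqP.
exists p; split=> // m P SP; split=> [|i j ij]; apply: pP.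
  by rewrite -mulrzl -freval1 ?idS ?mul0r //; apply: mS.
by apply: is_identity_Theta => //; [apply: mS | apply: idS].
Qed.

(** * Second-order expansion and the divisibility criterion *)

(** The scalars [x i] are central and gather into multiplicities, while the order in [n i * n j] is
    kept. Induction on m splits off the last factor. *)
Lemma prod_nilp3 (R : nzRingType) m (x : 'I_m -> nat) (n : 'I_m -> R) :
  (forall i j k, n i * n j * n k = 0) ->
  \prod_i ((x i)%:R + n i) = (\prod_i x i)%:R
    + \sum_i n i *+ (\prod_(k | k != i) x k)
    + \sum_(i < m) \sum_(j < m | (i < j)%N)
        (n i * n j) *+ (\prod_(k | (k != i) && (k != j)) x k).
Proof.
elim: m x n => [|m IHm] x n n3; first by rewrite !big_ord0 !addr0.
(* [w] embeds the first m indices; [E0] to [E2m] record what each product of scalars becomes when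
   the last index is separated. *)
pose w := @widen_ord m m.+1 (leqnSn m).
have neqm (k : 'I_m) : w k != ord_max by rewrite -val_eqE /= ltn_eqF.
have E0 : \prod_k x k = (\prod_k x (w k) * x ord_max)%N by rewrite big_ord_recr.
have E1 i : (\prod_(k | k != w i) x k =
    \prod_(k | k != i) x (w k) * x ord_max)%N.
  by rewrite !(big_mkcond (fun k => k != _)) big_ord_recr /= eq_sym neqm.
have E1m : (\prod_(k | k != ord_max) x k = \prod_k x (w k))%N.
  rewrite big_mkcond big_ord_recr /= eqxx muln1.
  by apply: eq_bigr => k _; rewrite neqm.
have E2 i j : (\prod_(k | (k != w i) && (k != w j)) x k =
    \prod_(k | (k != i) && (k != j)) x (w k) * x ord_max)%N.
  by rewrite !(big_mkcond (fun k => (k != _) && _)) big_ord_recr /=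
    !(eq_sym ord_max) !neqm.
have E2m i : (\prod_(k | (k != w i) && (k != ord_max)) x k =
    \prod_(k | k != i) x (w k))%N.
  rewrite big_mkcond big_ord_recr /= eqxx andbF muln1 [RHS]big_mkcond.
  by apply: eq_bigr => k _; rewrite neqm andbT.
rewrite big_ord_recr (IHm (x \o w) (n \o w)) /=; last by move=> *; apply: n3.
rewrite !mulrDr !mulrDl E0 natrM.
rewrite [\sum_(i < m.+1) n i *+ _]big_ord_recr /= E1m.
rewrite [\sum_(i < m.+1) \sum_(_ | _) _]big_ord_recr /=.
rewrite [X in _ = _ + (_ + X)]big1 => [|j]; last by rewrite ltnNge leq_ord.
rewrite addr0.
have -> : \sum_(i < m) n (w i) *+ (\prod_(k | k != w i) x k) =
    (\sum_i n (w i) *+ (\prod_(k | k != i) x (w k))) * (x ord_max)%:R.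
  rewrite mulr_suml; apply: eq_bigr => i _.
  by rewrite E1 mulrnA mulr_natr.
(* A pair with [j = ord_max] arises from a first-order term times [n ord_max], every other pair from
   a second-order term times [x ord_max]. *)
have -> : \sum_(i < m) \sum_(j : 'I_m.+1 | (i < j)%N) (n (w i) * n j) *+
      (\prod_(k | (k != w i) && (k != j)) x k) =
  (\sum_(i < m) \sum_(j < m | (i < j)%N) (n (w i) * n (w j)) *+
      (\prod_(k | (k != i) && (k != j)) x (w k))) * (x ord_max)%:R +
  (\sum_i n (w i) *+ (\prod_(k | k != i) x (w k))) * n ord_max.
  rewrite !mulr_suml -big_split; apply: eq_bigr => i _ /=.
  rewrite big_mkcond big_ord_recr /= ltn_ord E2m mulrnAl; congr (_ + _).
  rewrite mulr_suml [RHS]big_mkcond; apply: eq_bigr => j _ /=.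
  by case: ifP => // _; rewrite E2 mulrnA mulr_natr.
(* A second-order term times [n ord_max] has three nilpotent factors and vanishes. *)
rewrite [X in _ + (_ + X) = _](_ : _ = 0) ?addr0; last first.
  rewrite mulr_suml big1 // => i _; rewrite mulr_suml big1 // => j _.
  by rewrite mulrnAl n3 mul0rn.
by rewrite [_%:R * n _]mulr_natl -!addrA; do 2!congr (_ + _); apply: addrCA.
Qed.

(** [N] abstracts the augmentation ideal. Once the sum over permutations is moved inside, a product
    [g i * g j] carries the sum of the c_s over those s that place i before j. *)
Lemma is_identity_nilp3 (R : nzRingType) (N : R -> Prop) p m
    (P : {fralg int['I_m]}) :
  p%:R = 0 :> R ->
  (forall r : R, exists x n, N n /\ r = x%:R + n) ->
  (forall a b c, N a -> N b -> N c -> a * b * c = 0) ->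
  multilinear P ->
  (p%:Z %| freval (fun=> 1 : int) P)%Z ->
  (forall i j : 'I_m, (i < j)%N -> (p%:Z %| Theta i j P)%Z) ->
  is_identity R P.
Proof.
move=> p0 Rdec N3 mP pP pT r.
have pz (z : int) (a : R) : (p%:Z %| z)%Z -> a *~ z = 0.
  by case/dvdzP=> q ->; rewrite mulrzA -mulrzr -pmulrn p0 mulr0.
have [f fP] := choice (fun i => Rdec (r i)).
have [g gP] := choice fP; move: gP => {fP} fgP.
have n3 i j k : g i * g j * g k = 0.
  by apply: N3; [case: (fgP i)|case: (fgP j)|case: (fgP k)].
rewrite freval_multilinear //.
pose A := \prod_i f i; pose B := \sum_i g i *+ (\prod_(k | k != i) f k).
pose C i j := (g i * g j) *+ (\prod_(k | (k != i) && (k != j)) f k).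
(* Permuting the factors leaves the terms [A] and [B] of order 0 and 1 fixed; only the set of pairs
   in order 2 depends on s. *)
have prodE s : \prod_i r ((s : 'S_m) i) = A%:R + B
   + \sum_(i < m) \sum_(j < m | ((s^-1)%g i < (s^-1)%g j)%N) C i j.
  rewrite (eq_bigr (fun i => (f (s i))%:R + g (s i))); last first.
    by move=> i _; case: (fgP (s i)).
  rewrite prod_nilp3 //; congr (_ + _ + _).
  - by rewrite /A [in RHS](reindex_perm s).
  - rewrite /B [in RHS](reindex_perm s); apply: eq_bigr => i _ /=.
    rewrite [in RHS](reindex_perm s) /=; congr (_ *+ _); apply: eq_bigl => k.
    by rewrite (inj_eq perm_inj).
  - rewrite [in RHS](reindex_perm s); apply: eq_bigr => i _ /=.
    rewrite [in RHS](reindex_perm s); apply: eq_big => j /=;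
      first by rewrite !permK.
    move=> _; rewrite /C [in RHS](reindex_perm s); congr (_ *+ _); apply: eq_bigl => k.
    by rewrite !(inj_eq perm_inj).
rewrite (eq_bigr _ (fun s _ => congr1 (fun a => a *~ _) (prodE s))).
rewrite (eq_bigr _ (fun s _ => mulrzDl _ _ _)) big_split /=.
rewrite -mulrz_sumr sum_coeff // pz // add0r.
rewrite (eq_bigr (fun s : 'S_m => \sum_(i < m) \sum_(j < m)
  C i j *~ (if ((s^-1)%g i < (s^-1)%g j)%N then P@_(perm_word s) else 0)));
  last first.
  move=> s _; rewrite mulrz_suml; apply: eq_bigr => i _.
  rewrite mulrz_suml big_mkcond; apply: eq_bigr => j _.
  by case: ifP; rewrite ?mulr0z.
rewrite exchange_big big1 // => i _; rewrite exchange_big big1 // => j _ /=.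
rewrite -mulrz_sumr -big_mkcond.
case: (ltngtP i j) => [ij|ji|ij].
- exact/pz/pT.
(* For i > j the remaining permutations place j before i, so the coefficient is P(1,...,1) -
   Theta_ji. *)
- have := pP; rewrite -sum_coeff //.
  rewrite (bigID (fun s : 'S_m => ((s^-1)%g i < (s^-1)%g j)%N)) /=.
  rewrite rpredDr; first exact: pz.
  rewrite (eq_bigl (fun s : 'S_m => ((s^-1)%g j < (s^-1)%g i)%N)) ?pT // => s.
  rewrite -leqNgt [LHS]leq_eqVlt; case: eqP => // E.
  by move: ji; rewrite (perm_inj (val_inj E)) ltnn.
- by apply: pz; rewrite (val_inj ij) big_pred0 ?dvdz0 // => s; rewrite ltnn.
Qed.


(** * The span of 1, u, v and vu *)

Section UVSpan.
Variables (R : nzRingType) (u v : R).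
Hypotheses (uu : u * u = 0) (vv : v * v = 0) (uv : u * v = 0).

(** The relations leave only the words u, v and vu besides 1. Natural coefficients suffice for F_p,
    whose elements are images of natural numbers. *)
Definition uv_nil (r : R) : Prop :=
  exists b c d : nat, r = u *+ b + v *+ c + (v * u) *+ d.

Definition uv_span (r : R) : Prop := exists x n, uv_nil n /\ r = x%:R + n.

Lemma uv_nil0 : uv_nil 0.
Proof. by exists 0%N, 0%N, 0%N; rewrite !mulr0n !addr0. Qed.

Lemma uv_nilD x y : uv_nil x -> uv_nil y -> uv_nil (x + y).
Proof.
move=> [b1 [c1 [d1 ->]]] [b2 [c2 [d2 ->]]].
exists (b1 + b2)%N, (c1 + c2)%N, (d1 + d2)%N.
by rewrite !mulrnDr addrACA (addrACA (_ *+ b1)).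
Qed.

Lemma uv_nilMn x n : uv_nil x -> uv_nil (x *+ n).
Proof.
move=> [b [c [d ->]]]; exists (b * n)%N, (c * n)%N, (d * n)%N.
by rewrite !mulrnDl !mulrnA.
Qed.

(** Of the nine products of u, v and vu the relations leave only v times u; its coefficient is that
    of v in x times that of u in y. *)
Lemma uv_nilM_vu x y : uv_nil x -> uv_nil y -> exists d, x * y = (v * u) *+ d.
Proof.
move=> [b1 [c1 [d1 ->]]] [b2 [c2 [d2 ->]]]; exists (c1 * b2)%N.
rewrite !mulrDl !mulrDr !mulrnAl !mulrnAr !mulrA uu vv uv.
rewrite -(mulrA _ u u) -(mulrA _ u v) uu uv.
by rewrite !(mul0r, mulr0, mul0rn, add0r, addr0) -mulrnA mulnC.
Qed.

Lemma uv_nilM x y : uv_nil x -> uv_nil y -> uv_nil (x * y).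
Proof.
move=> nx ny; have [d ->] := uv_nilM_vu nx ny.
by exists 0%N, 0%N, d; rewrite !mulr0n !add0r.
Qed.

(** The product xy is a multiple of vu, which u, v and vu annihilate from the right. *)
Lemma uv_nil3 x y z : uv_nil x -> uv_nil y -> uv_nil z -> x * y * z = 0.
Proof.
move=> nx ny [b [c [d ->]]]; have [e ->] := uv_nilM_vu nx ny.
rewrite !mulrDr !mulrnAl !mulrnAr !mulrA -(mulrA _ u u) -(mulrA _ u v) uu uv.
by rewrite !(mul0r, mulr0, mul0rn, addr0).
Qed.

Lemma uv_spanD x y : uv_span x -> uv_span y -> uv_span (x + y).
Proof.
move=> [a [m [nm ->]]] [b [n [nn ->]]]; exists (a + b)%N, (m + n).
by split; [apply: uv_nilD | rewrite natrD addrACA].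
Qed.

Lemma uv_spanM x y : uv_span x -> uv_span y -> uv_span (x * y).
Proof.
move=> [a [m [nm ->]]] [b [n [nn ->]]].
exists (a * b)%N, (n *+ a + m *+ b + m * n); split.
  apply: uv_nilD; last exact: uv_nilM.
  by apply: uv_nilD; apply: uv_nilMn.
by rewrite mulrDl !mulrDr -natrM mulr_natl mulr_natr !addrA.
Qed.

Lemma uv_span_natr n : uv_span n%:R.
Proof. by exists n, 0; rewrite addr0; split=> //; apply: uv_nil0. Qed.

Lemma uv_span_u : uv_span u.
Proof.
exists 0%N, u; rewrite add0r; split=> //.
by exists 1%N, 0%N, 0%N; rewrite mulr1n !mulr0n !addr0.
Qed.

Lemma uv_span_v : uv_span v.
Proof.
exists 0%N, v; rewrite add0r; split=> //.
by exists 0%N, 1%N, 0%N; rewrite mulr1n !mulr0n addr0 add0r.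
Qed.
End UVSpan.

(** * The ring F_p{U,V}/(U^2,V^2,UV) *)

Section UVRing.
Variable p : nat.
Hypothesis p_prime : prime p.
Local Notation A := {fralg 'F_p['I_2]}.

Definition uvU : uvring p := \pi_(uvring p) (varU p).
Definition uvV : uvring p := \pi_(uvring p) (varV p).

Lemma piD (x y : A) :
  \pi_(uvring p) (x + y) = \pi_(uvring p) x + \pi_(uvring p) y.
Proof. by rewrite -iq_addE. Qed.

Lemma piM (x y : A) :
  \pi_(uvring p) (x * y) = \pi_(uvring p) x * \pi_(uvring p) y.
Proof. by rewrite -iq_mulrE. Qed.

Lemma pi_natr n : \pi_(uvring p) (n%:R : A) = n%:R.
Proof.
elim: n => [|n IHn]; first exact/esym/iq0E.
by rewrite !mulrSr piD IHn.
Qed.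

Lemma pi_gen (g : A) :
  g \in [:: varU p ^+ 2; varV p ^+ 2; varU p * varV p] ->
  \pi_(uvring p) g = 0.
Proof.
move=> gI; rewrite iq0E; apply/eqP; rewrite idealquot_eq subr0.
by apply/ideal_genP => J _; apply.
Qed.

Lemma uvUU : uvU * uvU = 0.
Proof. rewrite -piM; apply: pi_gen; exact: mem_head. Qed.

Lemma uvVV : uvV * uvV = 0.
Proof.
rewrite -piM; apply: pi_gen; rewrite in_cons; apply/orP; right.
exact: mem_head.
Qed.

Lemma uvUV : uvU * uvV = 0.
Proof.
rewrite -piM; apply: pi_gen; rewrite !in_cons; apply/orP; right.
by apply/orP; right; apply/orP; left.
Qed.

(** The polynomials whose coefficients vanish on all factors of the word VU form an ideal. It
    contains U^2, V^2 and UV, whose words are not factors of VU, but not VU itself. *)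
Lemma uvVU_neq0 : uvV * uvU != 0.
Proof.
rewrite -piM [0]iq0E idealquot_eq subr0; apply/negP => /ideal_genP VU.
(* U has index 0 and V index 1, so [[:: 1; 0]] is the word VU. *)
pose J (x : A) := forall k : {fmonom 'I_2}, infix k [:: 1; 0] -> x@_k = 0.
have UE (i j : 'I_2) : fvar 'F_p i * fvar 'F_p j = << mmul (fmu i) (fmu j) >>.
  by rewrite malgM_def fgmulUU mulr1.
(* If a concatenation is a factor of VU, so are both of its pieces. *)
have JM (x y : A) : J x \/ J y -> J (x * y).
  move=> Jxy k; apply: contraTeq; rewrite mcoeff_neq0 => /msuppM_le.
  case=> k1 [k2 [k1x k2y ->]]; rewrite fmM; apply/negP => kI.
  case: Jxy => [Jx|Jy].
    by move: k1x; rewrite -mcoeff_neq0 Jx ?eqxx // (catr_infix kI).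
  by move: k2y; rewrite -mcoeff_neq0 Jy ?eqxx // (catl_infix kI).
have /(_ (mmul (fmu 1) (fmu 0))) : J (varV p * varU p).
  apply: VU => [|g].
    split=> [k _|x y Jx Jy k kI|a x Jx|a x Jx]; first exact: mcoeff0.
    - by rewrite mcoeffB Jx // Jy // subr0.
    - by apply: JM; right.
    - by apply: JM; left.
  rewrite !inE => /or3P[]/eqP-> k kI; rewrite ?expr2 UE mcoeffU1;
    by case: eqP kI => // <-; rewrite fmM !fmU.
by rewrite UE mcoeffU1 eqxx fmM !fmU => /(_ isT)/eqP; rewrite oner_eq0.
Qed.

Lemma uvring_noncommutative : noncommutative (uvring p).
Proof. by move=> /(_ uvV uvU) VU; case/eqP: uvVU_neq0; rewrite VU uvUV. Qed.

Lemma uvring_char : p%:R = 0 :> uvring p.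
Proof.
rewrite -pi_natr -mpolyC_nat (_ : p%:R = 0) ?malgC0E -?iq0E //.
exact/pcharf0/pchar_Fp.
Qed.

(** The span contains U and V and is closed under products, so by induction on length it contains
    the image of every word; linear combinations follow. *)
Lemma uvringP (r : uvring p) : uv_span uvU uvV r.
Proof.
have DM := uv_spanM uvUU uvVV uvUV; have DN := uv_span_natr uvU uvV.
have Dvar (i : 'I_2) : uv_span uvU uvV (\pi_(uvring p) (fvar 'F_p i)).
  have [->|->] : i = 0 \/ i = 1.
    by case: i => [[|[|//]] lti]; [left|right]; apply: val_inj.
  - exact: uv_span_u.
  - exact: uv_span_v.
have Dmon (k : {fmonom 'I_2}) : uv_span uvU uvV (\pi_(uvring p) (<< k >> : A)).
  case: k; elim=> [|i k IHk].
    have -> : << FMonom [::] >> = 1%:R :> A by rewrite -fmoneE.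
    by rewrite pi_natr; apply: DN.
  have -> : << FMonom (i :: k) >> = fvar 'F_p i * << FMonom k >>.
    rewrite malgM_def fgmulUU mulr1; congr << _ >>.
    by apply/eqP; rewrite fmP fmM fmU.
  by rewrite piM; apply: DM.
rewrite -[r]reprK (monalgE (repr r)).
elim: (X in \sum_(_ <- X) _) => [|k s IHs].
  by rewrite big_nil -(mulr0n 1) pi_natr; apply: DN.
rewrite big_cons piD; apply: uv_spanD => //.
(* A scalar of F_p is the image of a natural number, so a monomial is a product of two elements with
   image in the span. *)
have -> c : << c *g k >> = (c : nat)%:R * << k >> :> A.
  by rewrite -mpolyC_nat malgM_def fgmulUU mul1m mulr1 natr_Zp.
by rewrite piM pi_natr; apply: DM.
Qed.
End UVRing.

(** * The equivalence and the witnessing ring *)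

Theorem theorem5p1
    (S : forall m : nat, {fralg int['I_m]} -> Prop)
    (S_multilinear : forall (m : nat) (P : {fralg int['I_m]}),
       S m P -> multilinear P) :
  ((exists R : nzRingType,
      noncommutative R /\
      forall (m : nat) (P : {fralg int['I_m]}), S m P -> is_identity R P)
   <->
   (exists p : nat, admissible_prime S p))
  /\
  (forall p : nat, admissible_prime S p ->
     noncommutative (uvring p) /\
     forall (m : nat) (P : {fralg int['I_m]}),
       S m P -> is_identity (uvring p) P).
Proof.
(* The explicit ring comes first, as it also provides the R required once a prime is given. *)
have uvP p : admissible_prime S p -> noncommutative (uvring p) /\
    forall m (P : {fralg int['I_m]}), S m P -> is_identity (uvring p) P.
  move=> [p_prime pS]; split=> [|m P SP]; first exact: uvring_noncommutative.
  have [pP pT] := pS m P SP.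
  apply: (is_identity_nilp3 (uvring_char p_prime) (@uvringP p)) => //.
    exact: (uv_nil3 (uvUU p) (uvVV p) (uvUV p)).
  exact: S_multilinear.
split=> //; split=> [[R [ncR idR]]|[p /uvP uvp]]; last by exists (uvring p).
exact: identity_admissible idR.
Qed.
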